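(* Let $n\ge 3$ and $m\ge 1$ be integers. Then $\chi_{la}(F_n\circ O_m)\ge m(n+1)+3$.
   Context: All graphs are finite, undirected, without loops or multiple edges. The fan graph $F_n$ ($n\ge 2$) is obtained from a path $P_n$ on $n$ vertices by adding one new vertex and joining it to every vertex of the path (so it has $n+1$ vertices and $2n-1$ edges). $O_m$ is the null graph (edgeless graph) of order $m\ge 1$. The corona product $G\circ H$ is the graph obtained by taking one copy of $G$ and $|V(G)|$ disjoint copies of $H$, and joining the $i$-th vertex of $G$ to every vertex of the $i$-th copy of $H$, for $1\le i\le |V(G)|$; thus $G\circ O_m$ is $G$ with $m$ pendant vertices attached to each vertex of $G$. For a connected graph $G=(V,E)$ with $q=|E|$ and a bijection $f:E\to\{1,2,\dots,q\}$, the weight of a vertex $u$ is $w(u)=\sum_{e\in E(u)} f(e)$, where $E(u)$ is the set of edges incident to $u$. The bijection $f$ is a local antimagic labeling of $G$ if $w(u)\ne w(v)$ for every two adjacent vertices $u,v$. Assigning the color $w(u)$ to each vertex $u$ then gives a proper vertex coloring of $G$, whose number of colors is the number of distinct values of $w$. The local antimagic chromatic number $\chi_{la}(G)$ is the minimum number of distinct colors $|\{w(u): u\in V\}|$ over all local antimagic labelings $f$ of $G$. *)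

(* Defs.v *)
From mathcomp Require Import all_boot.

Set Implicit Arguments.
Unset Strict Implicit.
Unset Printing Implicit Defensive.

Record sgraph := SGraph {
  vertex :> finType;
  adj : rel vertex;
  adj_sym : symmetric adj;
  adj_irrefl : irreflexive adj }.

Definition edges (G : sgraph) : {set {set G}} :=
  [set e | [exists u : G, exists v : G, adj u v && (e == [set u; v])]].

Definition edge (G : sgraph) := {e : {set G} | e \in edges G}.

Definition null_adj m : rel 'I_m := fun _ _ => false.

Lemma null_adj_sym m : symmetric (@null_adj m).
Proof. by []. Qed.

Lemma null_adj_irrefl m : irreflexive (@null_adj m).
Proof. by []. Qed.

Definition null_graph m : sgraph :=
  SGraph (@null_adj_sym m) (@null_adj_irrefl m).

Definition path_adj n : rel 'I_n := fun i j => (i.+1 == j) || (j.+1 == i).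

Lemma path_adj_sym n : symmetric (@path_adj n).
Proof. by move=> i j; rewrite /path_adj orbC. Qed.

Lemma path_adj_irrefl n : irreflexive (@path_adj n).
Proof. by move=> i; rewrite /path_adj orbb eqn_leq ltnn. Qed.

Definition path_graph n : sgraph :=
  SGraph (@path_adj_sym n) (@path_adj_irrefl n).

(* The vertex added to G is None. *)
Definition cone_adj (G : sgraph) : rel (option G) := fun x y =>
  match x, y with
  | Some u, Some v => adj u v
  | None, None => false
  | _, _ => true
  end.

Lemma cone_adj_sym G : symmetric (@cone_adj G).
Proof. by case=> [u|] [v|] //=; exact: adj_sym. Qed.

Lemma cone_adj_irrefl G : irreflexive (@cone_adj G).
Proof. by case=> [u|] //=; exact: adj_irrefl. Qed.

Definition cone (G : sgraph) : sgraph :=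
  SGraph (@cone_adj_sym G) (@cone_adj_irrefl G).

Definition fan n : sgraph := cone (path_graph n).

(* inl u is the vertex u of G; inr (u, x) is the vertex x of the copy of H
   attached to u. *)
Definition corona_adj (G H : sgraph) : rel (G + G * H) := fun x y =>
  match x, y with
  | inl u, inl v => adj u v
  | inl u, inr (v, _) => u == v
  | inr (u, _), inl v => u == v
  | inr (u, a), inr (v, b) => (u == v) && adj a b
  end.

Lemma corona_adj_sym G H : symmetric (@corona_adj G H).
Proof.
case=> [u|[u a]] [v|[v b]] /=; rewrite 1?eq_sym //; first exact: adj_sym.
by rewrite adj_sym.
Qed.

Lemma corona_adj_irrefl G H : irreflexive (@corona_adj G H).
Proof. by case=> [u|[u a]] /=; rewrite ?eqxx adj_irrefl. Qed.

Definition corona (G H : sgraph) : sgraph :=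
  SGraph (@corona_adj_sym G H) (@corona_adj_irrefl G H).

Section LocalAntimagic.

Variable G : sgraph.

(* An edge e carries the label (f e).+1, so that labels range over
   {1, ..., q} with q the number of edges. *)
Definition labeling := {ffun edge G -> 'I_#|edges G|}.

Definition weight (f : labeling) (u : G) : nat :=
  \sum_(e : edge G | u \in val e) (f e).+1.

(* Injectivity amounts to bijectivity here: see local_antimagicP. *)
Definition local_antimagic (f : labeling) : bool :=
  injectiveb f &&
  [forall u : G, forall v : G, adj u v ==> (weight f u != weight f v)].

Lemma local_antimagicP (f : labeling) :
  reflect (bijective f /\ forall u v : G, adj u v -> weight f u <> weight f v)
          (local_antimagic f).
Proof.
apply: (iffP andP) => [[/injectiveP f_inj /forallP wP]|[f_bij wP]]; split.
- by apply: inj_card_bij => //; rewrite card_ord card_sig.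
- by move=> u v uv; apply/eqP; move/forallP: (wP u) => /(_ v)/implyP; apply.
- by apply/injectiveP; exact: bij_inj.
- by apply/forallP=> u; apply/forallP=> v; apply/implyP=> uv; apply/eqP/wP.
Qed.

Definition num_colors (f : labeling) : nat :=
  size (undup [seq weight f u | u : G]).

(* The junk value 0 is taken when G has no local antimagic labeling, so a
   positive lower bound on chi_la entails that one exists. *)
Definition chi_la : nat :=
  if [pick f | local_antimagic f] is Some f0
  then num_colors [arg min_(f < f0 | local_antimagic f) num_colors f]
  else 0.

Lemma chi_la_attained (f0 : labeling) : local_antimagic f0 ->
  exists2 f, local_antimagic f & chi_la = num_colors f.
Proof.
rewrite /chi_la; case: pickP => [f1 f1P _|/(_ f0) ->] //.
by case: arg_minnP => // f fP _; exists f.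
Qed.

Lemma chi_la_le (f : labeling) : local_antimagic f -> chi_la <= num_colors f.
Proof.
move=> fP; rewrite /chi_la; case: pickP => [f1 f1P|//].
by case: arg_minnP => // g _; apply.
Qed.

End LocalAntimagic.

(* Main.v *)
(** The m(n+1) pendant vertices have distinct colors, namely the labels of their
    edges, all at most q.  The hub has degree n+m, hence a weight above q.  If
    there were no two adjacent path vertices of weight above q, the path
    vertices of weight at most q would cover the path, and the edges incident
    to them would be too many for distinct labels with such a small sum.  So
    two more colors above q occur, distinct from that of the hub.

    As [chi_la] is 0 when no local antimagic labeling exists, one must also
    be exhibited: label the path edges 1, ..., n-1 in order, then give consecutive
    blocks of m+1 labels to the spoke and pendant edges of the last path vertex,
    of the first, of the second, and so on, and the m largest labels to the
    pendant edges of the hub. *)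

Require Import Defs.
From mathcomp Require Import all_boot.
From mathcomp Require Import zify.

Set Implicit Arguments.
Unset Strict Implicit.
Unset Printing Implicit Defensive.

(** * Numerical inequalities and sums of distinct labels *)

Lemma set2_inj (T : finType) (a b c d : T) :
  [set a; b] = [set c; d] -> (a = c /\ b = d) \/ (a = d /\ b = c).
Proof.
move=> E.
have := set21 a b; have := set22 a b; rewrite E !inE.
have := set21 c d; have := set22 c d; rewrite -E !inE.
by do 4![case/orP=> /eqP ?]; subst; auto.
Qed.

(** Induction on the number of elements: s distinct positive labels have a maximum of at least s.
    The cardinal is written as a sum of ones so that the formulas splitting sums over edges apply to
    it too. *)
Lemma leq_sum_inj (T : finType) (g : T -> nat) (P : pred T) : injective g ->
  (\sum_(t | P t) 1) * (\sum_(t | P t) 1).+1 <= 2 * \sum_(t | P t) (g t).+1.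
Proof.
move=> g_inj; have setE F : \sum_(t | P t) F t = \sum_(t in [set t | P t]) F t.
  by apply: eq_bigl => t; rewrite inE.
rewrite !setE sum1_card; move: [set t | P t] => A {P setE}.
move: {2}#|A| (erefl #|A|) => s.
elim: s A => [|s IHs] A As; first by rewrite As.
have /card_gt0P[a0 Aa0] : 0 < #|A| by rewrite As.
case: (@arg_maxnP _ a0 [in A] g Aa0) => a /= Aa a_max.
have A'E : #|A :\ a| = s by move: As; rewrite (cardsD1 a) Aa => -[].
have ga : #|A| <= (g a).+1.
  rewrite -[X in _ <= X]card_ord.
  rewrite -(@card_in_image _ _ (fun t => inord (g t) : 'I_(g a).+1) A).
    exact: max_card.
  move=> x y Ax Ay /(congr1 val) /=.
  by rewrite !inordK ?ltnS; [exact: g_inj | exact: a_max | exact: a_max].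
rewrite (big_setD1 a Aa) /=; have := IHs _ A'E; rewrite A'E.
by rewrite As in ga *; nia.
Qed.

(** Compares the number of edges with the least sum of [k.+1 + m] distinct labels, those at the
    hub. *)
Lemma hub_ineq k m : 1 < k ->
  2 * (k + k.+1 + k.+2 * m) < (k.+1 + m) * (k.+1 + m).+1.
Proof.
move=> k1; have [a ->] : exists a, k = a.+2 by exists k.-2; lia.
case: m => [|m]; nia.
Qed.

(** Here [s] is the size of a vertex cover of the path. The left side is twice the weight available
    at light vertices, the right side twice the least sum of the labels on the edges they meet: [k]
    path edges and [m.+1] others for each vertex. *)
Lemma cover_ineq k m s : 1 < k -> 0 < m -> k <= 2 * s ->
  2 * (s * (k + k.+1 + k.+2 * m)) < (k + s * m.+1) * (k + s * m.+1).+1.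
Proof.
move=> k1 m0 ks.
have [d dE] : exists d, 2 * s = k + d by exists (2 * s - k); lia.
have [a ->] : exists a, m = a.+1 by exists m.-1; lia.
have [b kE] : exists b, k = b.+2 by exists k.-2; lia.
have -> : k + s * a.+2 = 2 * k + d + s * a by lia.
have -> : 2 * (s * (k + k.+1 + k.+2 * a.+1)) =
  (k + d) * (3 * k + 3) + s * a * (2 * (k + 2)) by rewrite -dE; lia.
(* Bounding the terms with a factor [s * a] separately reduces the claim to [a = 0], that is
   [m = 1]. *)
have aux : s * a * (2 * (k + 2)) <= s * a * (2 * (2 * k + d) + 1).
  by apply: leq_mul => //; lia.
suff : (k + d) * (3 * k + 3) < (2 * k + d) * (2 * k + d).+1 by nia.
rewrite kE; nia.
Qed.

(** Path edge [j] joins path vertices [j] and [j.+1]. The last term vanishes at [i = 0], where no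
    edge precedes the vertex. *)
Lemma sum_path_labels k i :
  \sum_(j < k | (j == i :> nat) || (j.+1 == i)) j.+1 =
  (i < k) * i.+1 + (i <= k) * i.
Proof.
rewrite big_mkcond; elim: k => [|k IHk]; first by rewrite big_ord0; case: i.
by rewrite big_ord_recr IHk /=; case: ifP; case: (ltngtP i k); lia.
Qed.

Lemma mulnD_inj d a b x y : x < d -> y < d ->
  a * d + x = b * d + y -> a = b /\ x = y.
Proof.
move=> xd yd E; have d_gt0 : 0 < d by lia.
have := congr1 (divn^~ d) E; have := congr1 (modn^~ d) E.
by rewrite !modnMDl !divnMDl // !modn_small // !divn_small // !addn0.
Qed.

Lemma big_option (T : finType) (F : option T -> nat) :
  \sum_c F c = F None + \sum_t F (Some t).
Proof.
rewrite ![index_enum _]unlock [@Finite.enum in LHS]unlock /=.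
by rewrite big_cons big_map.
Qed.

(** * Explicit description of the edges of the corona *)

Section FanCorona.

Variables k m : nat.

Local Notation G := (corona (fan k.+1) (null_graph m)).
(** Index type of the edges: path edges, spokes, pendant edges. With n = [k.+1], the path edges are
    indexed by ['I_k]; [None] stands for the hub. *)
Local Notation D := ('I_k + 'I_k.+1 + option 'I_k.+1 * 'I_m)%type.

Definition fc_path (j : 'I_k) : D := inl (inl j).
Definition fc_spoke (i : 'I_k.+1) : D := inl (inr i).
Definition fc_pend (c : option 'I_k.+1) (x : 'I_m) : D := inr (c, x).

Definition core (c : option 'I_k.+1) : G := inl c.
Definition leaf (c : option 'I_k.+1) (x : 'I_m) : G := inr (c, x).

Definition fc_ends (d : D) : {set G} :=
  match d with
  | inl (inl j) =>
      [set core (Some (widen_ord (leqnSn k) j)); core (Some (lift ord0 j))]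
  | inl (inr i) => [set core None; core (Some i)]
  | inr (c, x) => [set core c; leaf c x]
  end.

Lemma fc_ends_edge d : fc_ends d \in edges G.
Proof.
rewrite inE; case: d => [[j|i]|[c x]] /=; apply/existsP.
- exists (core (Some (widen_ord (leqnSn k) j))); apply/existsP.
  exists (core (Some (lift ord0 j))); rewrite eqxx andbT /=.
  by rewrite /path_adj /= eqxx.
- exists (core None); apply/existsP; exists (core (Some i)).
  by rewrite eqxx andbT.
- exists (core c); apply/existsP; exists (leaf c x).
  by rewrite /= !eqxx.
Qed.

Definition fc_edge (d : D) : edge G := Sub (fc_ends d) (fc_ends_edge d).

Lemma fc_ends_inj : injective fc_ends.
Proof.
case=> [[j|i]|[c x]] [[j'|i']|[c' x']] /= /set2_inj[[]|[]] //.
- by move=> [/val_inj ->].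
(* Two path edges with swapped ends would give j = j' + 1 and j' = j + 1. *)
- move=> [E1] [E2]; exfalso.
  by move: E1 E2; rewrite /bump /=; lia.
- by move=> _ [->].
- by move=> [->] [->].
Qed.

Lemma fc_edge_bij : bijective fc_edge.
Proof.
apply: inj_card_bij; first by move=> d d' [/fc_ends_inj].
suff sub : edges G \subset [set fc_ends d | d : D].
  rewrite card_sig; apply: leq_trans (subset_leq_card sub) _.
  by rewrite card_imset //; exact: fc_ends_inj.
apply/subsetP=> e; rewrite inE => /existsP[u /existsP[v /andP[uv /eqP ->]]].
have pathP (i j : 'I_k.+1) : i.+1 = j ->
    [set core (Some i); core (Some j)] \in [set fc_ends d | d : D].
  move=> ij; have ik : i < k by have := ltn_ord j; rewrite -ij ltnS.
  apply/imsetP; exists (fc_path (Ordinal ik)) => //=.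
  by congr [set core (Some _); core (Some _)]; apply: val_inj.
case: u v uv => [[i|]|[c x]] [[j|]|[c' x']] //=.
- case/orP=> /eqP ij; first exact: pathP.
  by rewrite setUC; apply: pathP.
- by move=> _; rewrite setUC; apply/imsetP; exists (fc_spoke i).
- by move=> /eqP <-; apply/imsetP; exists (fc_pend (Some i) x').
- by move=> _; apply/imsetP; exists (fc_spoke j).
- by move=> /eqP <-; apply/imsetP; exists (fc_pend None x').
- by move=> /eqP ->; rewrite setUC; apply/imsetP; exists (fc_pend (Some j) x).
- by move=> /eqP ->; rewrite setUC; apply/imsetP; exists (fc_pend None x).
- by rewrite andbF.
Qed.

Lemma card_fc_edges : #|edges G| = k + k.+1 + k.+2 * m.
Proof.
have := bij_eq_card fc_edge_bij.
by rewrite card_sig !card_sum card_prod card_option !card_ord => <-.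
Qed.

(** * Weights split by kind of edge *)

Lemma weight_fc (f : labeling G) (u : G) :
  weight f u = \sum_(d | u \in fc_ends d) (f (fc_edge d)).+1.
Proof.
rewrite /weight (reindex fc_edge) //=.
exact/onW_bij/fc_edge_bij.
Qed.

Lemma sum_fc (P : pred D) (F : D -> nat) :
  \sum_(d | P d) F d =
  \sum_(j | P (fc_path j)) F (fc_path j) +
  \sum_(i | P (fc_spoke i)) F (fc_spoke i) +
  (\sum_(x | P (fc_pend None x)) F (fc_pend None x) +
   \sum_i \sum_(x | P (fc_pend (Some i) x)) F (fc_pend (Some i) x)).
Proof.
rewrite !big_sumType /=; congr (_ + _).
pose H c x := if P (inr (c, x)) then F (inr (c, x)) else 0.
rewrite big_mkcond (eq_bigr (fun p => H p.1 p.2)) => [|[]] //.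
rewrite -(pair_bigA _ H) big_option /= -big_mkcond; congr (_ + _).
by apply: eq_bigr => i _; rewrite -big_mkcond.
Qed.

Lemma sum_leaf (F : D -> nat) c x :
  \sum_(d | leaf c x \in fc_ends d) F d = F (fc_pend c x).
Proof.
apply: big_pred1 => -[[j|i]|[c' x']]; rewrite !inE //=.
by rewrite eq_sym.
Qed.

Lemma sum_hub (F : D -> nat) :
  \sum_(d | core None \in fc_ends d) F d =
  \sum_i F (fc_spoke i) + \sum_x F (fc_pend None x).
Proof.
rewrite sum_fc big_pred0 ?add0n; last by move=> j; rewrite !inE.
rewrite [\sum_i \sum_(x | _) _]big1 ?addn0; last first.
  by move=> i _; rewrite big_pred0 // => x; rewrite !inE.
by congr (_ + _); apply: eq_bigl => ?; rewrite !inE.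
Qed.

Lemma sum_path_vertex (F : D -> nat) (i : 'I_k.+1) :
  \sum_(d | core (Some i) \in fc_ends d) F d =
  \sum_(j : 'I_k | (j == i :> nat) || (j.+1 == i)) F (fc_path j) +
  F (fc_spoke i) + \sum_x F (fc_pend (Some i) x).
Proof.
rewrite sum_fc; congr (_ + _ + _).
- apply: eq_bigl => j; rewrite !inE /=.
  by congr orb; exact: eq_sym.
- by apply: big_pred1 => i'; rewrite !inE /= eq_sym.
- rewrite big_pred0 ?add0n => [|x]; last by rewrite !inE.
  rewrite (bigD1 i) //= [X in _ + X]big1 ?addn0.
    by apply: eq_bigl => x; rewrite !inE eqxx.
  move=> i' i'i; rewrite big_pred0 // => x; rewrite !inE orbF.
  by apply/negbTE; apply: contra i'i => /eqP[->].
Qed.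

(** * The lower bound for an arbitrary labeling *)

Section LowerBound.

Variable f : labeling G.
Hypotheses (f_inj : injective f) (k_gt1 : 1 < k) (m_gt0 : 0 < m).

Local Notation q := (k + k.+1 + k.+2 * m).
Local Notation F := (fun d => (f (fc_edge d)).+1).

Let label_inj : injective (fun d => f (fc_edge d) : nat).
Proof. by move=> d d' /val_inj/f_inj/(bij_inj fc_edge_bij). Qed.

Lemma weight_leaf_le c x : weight f (leaf c x) <= q.
Proof.
rewrite weight_fc sum_leaf -card_fc_edges; exact: ltn_ord.
Qed.

Lemma weight_hub_gt : q < weight f (core None).
Proof.
have := leq_sum_inj (fun d => core None \in fc_ends d) label_inj.
rewrite -weight_fc (sum_hub (fun=> 1)) !sum1_card !card_ord.
by have := hub_ineq m k_gt1; lia.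
Qed.

Lemma light_vertices_not_cover (S : {set 'I_k.+1}) :
    (forall i, i \in S -> weight f (core (Some i)) <= q) ->
  exists j : 'I_k,
    (widen_ord (leqnSn k) j \notin S) && (lift ord0 j \notin S).
Proof.
move=> S_light; apply/existsP; apply: contraT.
rewrite negb_exists => /forallP cov.
(* If [S] covers the path, [A] consists of the edges that meet [S], so it contains every path
   edge. *)
pose A : pred D := fun d => match d with
  | inl (inl _) => true
  | inl (inr i) => i \in S
  | inr (None, _) => false
  | inr (Some i, _) => i \in S
  end.
have sumA (H : D -> nat) : \sum_(d in A) H d = \sum_j H (fc_path j) +
    \sum_(i in S) (H (fc_spoke i) + \sum_x H (fc_pend (Some i) x)).
  rewrite sum_fc big_split /= -addnA; congr (_ + (_ + _)).
  rewrite big_pred0 // add0n [RHS]big_mkcond; apply: eq_bigr => i _.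
  case iS: (i \in S); first by apply: eq_bigl => x; exact: iS.
  by rewrite big_pred0 // => x; exact: iS.
have path_le (H : 'I_k -> nat) : \sum_j H j <=
    \sum_(i in S) \sum_(j : 'I_k | (j == i :> nat) || (j.+1 == i)) H j.
  rewrite (exchange_big_dep predT) //=; apply: leq_sum => j _.
  have := cov j; rewrite negb_and !negbK => /orP[] jS.
    by rewrite (bigD1 (widen_ord (leqnSn k) j)) /= ?leq_addr // jS eqxx.
  by rewrite (bigD1 (lift ord0 j)) /= ?leq_addr // jS eqxx orbT.
(* Each path vertex lies on at most two path edges, [i.-1] and [i]. *)
have k_le : k <= 2 * #|S|.
  have := path_le (fun=> 1); rewrite sum1_card card_ord => /leq_trans; apply.
  rewrite mulnC -sum_nat_const; apply: leq_sum => i _.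
  rewrite sum1_card cardE -(size_map val).
  apply: (@uniq_leq_size _ _ [:: i.-1; i : nat]).
    by rewrite map_inj_uniq ?enum_uniq //; exact: val_inj.
  move=> _ /mapP[j + ->]; rewrite mem_enum !inE => /orP[] /eqP <-.
    by rewrite eqxx orbT.
  by rewrite eqxx.
have := leq_sum_inj [in A] label_inj.
have -> : \sum_(d in A) 1 = k + #|S| * m.+1.
  rewrite sumA sum1_card card_ord; congr (_ + _).
  by rewrite -sum_nat_const; apply: eq_bigr => i _; rewrite sum1_card card_ord.
(* Adding the weights over [S] counts each edge of [A] at least once. *)
have : \sum_(d in A) F d <= #|S| * q.
  rewrite -sum_nat_const sumA.
  apply: leq_trans (leq_sum _ (fun i iS => S_light i iS)).
  under [X in _ <= X]eq_bigr => i _ do rewrite weight_fc sum_path_vertex -addnA.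
  by rewrite [X in _ <= X]big_split leq_add2r path_le.
move: (\sum_(d in A) _) => W W_le W_ge.
have := cover_ineq k_gt1 m_gt0 k_le.
by rewrite ltnNge (leq_trans W_ge) // leq_mul2l.
Qed.

Lemma two_heavy_colors :
    (forall u v : G, adj u v -> weight f u <> weight f v) ->
  exists i j, [/\ q < weight f (core (Some i)), q < weight f (core (Some j))
                & weight f (core (Some i)) != weight f (core (Some j))].
Proof.
move=> f_proper.
have [i|j] := @light_vertices_not_cover
  [set i | weight f (core (Some i)) <= q]; first by rewrite inE.
rewrite !inE -!ltnNge => /andP[heavy1 heavy2].
exists (widen_ord (leqnSn k) j), (lift ord0 j); split=> //.
apply/eqP/f_proper => /=.
by rewrite /path_adj /= eqxx.
Qed.

Lemma num_colors_ge : (forall u v : G, adj u v -> weight f u <> weight f v) ->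
  m * k.+2 + 3 <= num_colors f.
Proof.
move=> f_proper; have [i [j [wi wj wij]]] := two_heavy_colors f_proper.
pose cores : seq G := [:: core None; core (Some i); core (Some j)].
pose leaves : seq G := [seq leaf p.1 p.2 | p : option 'I_k.+1 * 'I_m].
have -> : m * k.+2 + 3 = size (map (weight f) (leaves ++ cores)).
  rewrite size_map size_cat size_map -cardE card_prod card_option !card_ord.
  by rewrite mulnC.
apply: uniq_leq_size => [|w]; last first.
  by rewrite mem_undup => /mapP[u _ ->]; apply: map_f; rewrite mem_enum.
rewrite map_cat cat_uniq; apply/and3P; split.
- rewrite -map_comp map_inj_uniq ?enum_uniq // => -[c x] [c' x'] /=.
  by rewrite !weight_fc !sum_leaf => -[] /label_inj[-> ->].
- apply/hasPn=> w /mapP[u u_hub ->]; apply/negP=> /mapP[v /mapP[[c x] _ ->]] wE.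
  have := weight_leaf_le c x; rewrite -wE leqNgt => /negP; apply.
  by move: u_hub; rewrite !inE => /or3P[] /eqP-> //; exact: weight_hub_gt.
(* The hub is adjacent to both heavy path vertices. *)
- rewrite /= !inE negb_or wij andbT.
  by rewrite !andbT; apply/andP; split; apply/eqP; apply: f_proper.
Qed.

End LowerBound.

(** * Construction of a local antimagic labeling *)

Section Existence.

Hypothesis k_gt1 : 1 < k.

(* The last path vertex has only one path edge, so if its block came
   last, its weight might equal that of its neighbor: its block comes first. *)
Definition block (i : nat) : nat := if i == k then 0 else i.+1.

(** Values are labels minus one. The spoke has the largest label of its block; the hub has block
    [k.+1], with no spoke. *)
Definition fc_label (d : D) : nat :=
  match d with
  | inl (inl j) => j
  | inl (inr i) => k + (block i * m.+1 + m)
  | inr (Some i, x) => k + (block i * m.+1 + x)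
  | inr (None, x) => k + (k.+1 * m.+1 + x)
  end.

Lemma block_le (i : 'I_k.+1) : block i <= k.
Proof. by rewrite /block; case: eqP; have := ltn_ord i; lia. Qed.

Lemma block_inj : injective (fun i : 'I_k.+1 => block i).
Proof.
move=> i j; rewrite /block.
by do 2!case: eqP => ?; move=> ?; apply: val_inj => /=; lia.
Qed.

Lemma fc_label_inj : injective fc_label.
Proof.
have in_block a b (x y : nat) : x < m.+1 -> y < m.+1 ->
    k + (a * m.+1 + x) = k + (b * m.+1 + y) -> a = b /\ x = y.
  by move=> xm ym /addnI; exact: mulnD_inj.
have xm (x : 'I_m) : x < m.+1 by exact: leqW.
case=> [[j|i]|[[i|] x]] [[j'|i']|[[i'|] x']] /=.
- by move=> /val_inj->.
- by have := ltn_ord j; lia.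
- by have := ltn_ord j; lia.
- by have := ltn_ord j; lia.
- by have := ltn_ord j'; lia.
- by move=> /in_block[] // /block_inj->.
- by move=> /in_block[] //; have := ltn_ord x'; lia.
- by move=> /in_block[] //; have := ltn_ord x'; lia.
- by have := ltn_ord j'; lia.
- by move=> /in_block[] //; have := ltn_ord x; lia.
- by move=> /in_block[]; rewrite ?xm // => /block_inj-> /val_inj->.
- by move=> /in_block[]; rewrite ?xm //; have := block_le i; lia.
- by have := ltn_ord j'; lia.
- by move=> /in_block[] //; have := ltn_ord x; lia.
- by move=> /in_block[]; rewrite ?xm //; have := block_le i'; lia.
- by move=> /addnI/addnI/val_inj->.
Qed.

Lemma fc_label_lt d : fc_label d < #|edges G|.
Proof.
rewrite card_fc_edges; case: d => [[j|i]|[[i|] x]] /=.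
- by have := ltn_ord j; lia.
- by have := block_le i; nia.
- by have := block_le i; have := ltn_ord x; nia.
- by have := ltn_ord x; nia.
Qed.

Lemma sum_pend_labels c :
  \sum_(x < m) (k + (c + x)).+1 = m * (k + c) + \sum_(x < m) x.+1.
Proof.
under eq_bigr => x _ do rewrite addnA -addnS.
by rewrite big_split sum_nat_const card_ord.
Qed.

Lemma fc_label_vertex (i : 'I_k.+1) :
  \sum_(d | core (Some i) \in fc_ends d) (fc_label d).+1 =
  (i < k) * i.+1 + i + (k + (block i * m.+1 + m)).+1 +
  (m * (k + block i * m.+1) + \sum_(x < m) x.+1).
Proof.
rewrite sum_path_vertex /= sum_path_labels.
have -> : i <= k by rewrite -ltnS.
by rewrite mul1n sum_pend_labels.
Qed.

(** The spoke of [i] counts on both sides, and the pendant labels at the hub dominate those at [i].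
    The [k] other spokes outweigh the path edges at [i], which bring at most [2 * k]. *)
Lemma fc_label_hub_gt (i : 'I_k.+1) :
  \sum_(d | core (Some i) \in fc_ends d) (fc_label d).+1 <
  \sum_(d | core None \in fc_ends d) (fc_label d).+1.
Proof.
rewrite fc_label_vertex sum_hub /= sum_pend_labels (bigD1 i) //=.
have spokes : k * (k + m).+1 <=
    \sum_(i' < k.+1 | i' != i) (k + (block i' * m.+1 + m)).+1.
  have -> : k * (k + m).+1 = \sum_(i' < k.+1 | i' != i) (k + m).+1.
    by rewrite sum_nat_const cardC1 card_ord.
  by apply: leq_sum => i' _; lia.
have pend : m * (k + block i * m.+1) <= m * (k + k.+1 * m.+1).
  by rewrite leq_mul2l leq_add2l leq_mul2r (leqW (block_le i)) !orbT.
have ik : i <= k by rewrite -ltnS.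
have path_le : (i < k) * i.+1 + i <= 2 * k by case: ltngtP ik; lia.
have k2 : 2 * k < k * (k + m).+1 by nia.
by move: spokes pend; move: (\sum_(_ < _ | _) _) (\sum_(_ < _) _); lia.
Qed.

(** The weight rises from each path vertex to the next, except at the last one, where the block
    number drops to 0 and a path edge is missing, so that the weight falls. *)
Lemma fc_label_path_neq (i j : 'I_k.+1) : i.+1 = j ->
  \sum_(d | core (Some i) \in fc_ends d) (fc_label d).+1 !=
  \sum_(d | core (Some j) \in fc_ends d) (fc_label d).+1.
Proof.
move=> ij; rewrite !fc_label_vertex -ij /block.
have ik : i < k by rewrite -ltnS ij.
move: (\sum_(_ < _) _) => T; rewrite ik (ltn_eqF ik).
case: (i.+1 =P k) => ik1; first by rewrite ik1 ltnn; nia.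
by rewrite (_ : i.+1 < k); [nia | lia].
Qed.

Lemma local_antimagic_exists : exists f : labeling G, local_antimagic f.
Proof.
have [h hK Kh] := fc_edge_bij.
pose f : labeling G := [ffun e => Ordinal (fc_label_lt (h e))].
have fE d : f (fc_edge d) = fc_label d :> nat by rewrite ffunE /= hK.
have wE u : weight f u = \sum_(d | u \in fc_ends d) (fc_label d).+1.
  by rewrite weight_fc; apply: eq_bigr => d _; rewrite fE.
(* At a path vertex the spoke label alone exceeds the pendant label; at the hub the pendant label is
   one term of the weight and a spoke adds to it. *)
have wlt c x : weight f (leaf c x) < weight f (core c).
  rewrite !wE sum_leaf; case: c => [i|].
    by rewrite fc_label_vertex /=; have := ltn_ord x; nia.
  rewrite sum_hub (bigD1 x) //= (bigD1 ord0) //=; lia.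
exists f; apply/local_antimagicP; split.
  apply: inj_card_bij; last by rewrite card_ord card_sig.
  move=> e e' /(congr1 val); rewrite !ffunE /= => /fc_label_inj.
  exact: (can_inj Kh).
have hub_neq i : weight f (core (Some i)) != weight f (core None).
  by rewrite !wE ltn_eqF //; exact: fc_label_hub_gt.
have leaf_neq c x : weight f (leaf c x) != weight f (core c).
  by rewrite ltn_eqF // wlt.
case=> [[i|]|[c x]] [[j|]|[c' x']] //= uv; apply/eqP.
- case/orP: uv => /eqP ij; rewrite !wE; first exact: fc_label_path_neq.
  by rewrite eq_sym; exact: fc_label_path_neq.
- exact: hub_neq.
- by rewrite eq_sym (eqP uv); exact: leaf_neq.
- by rewrite eq_sym; exact: hub_neq.
- by rewrite eq_sym (eqP uv); exact: leaf_neq.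
- by rewrite (eqP uv); exact: leaf_neq.
- by rewrite (eqP uv); exact: leaf_neq.
- by rewrite andbF in uv.
Qed.

End Existence.

End FanCorona.

Theorem lemma2p2 (n m : nat) (hn : 3 <= n) (hm : 1 <= m) :
  m * (n + 1) + 3 <= chi_la (corona (fan n) (null_graph m)).
Proof.
case: n hn => // k k_gt1; have [f0 f0P] := local_antimagic_exists m k_gt1.
have [f /local_antimagicP[f_bij f_proper] ->] := chi_la_attained f0P.
by rewrite addn1; apply: num_colors_ge => //; exact: bij_inj.
Qed.
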